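(* Let $(\Omega,\mathcal F)$ be a measurable space, $\nu:\mathcal F\to[0,1]$ a convex capacity continuous at $\Omega$, and $\mathbf f=\{f_n\}_{n\in\mathbb N}$ a sequence of bounded $\mathcal F$-measurable functions $f_n:\Omega\to\mathbb R$. If $\mathbf f$ is stationary and ergodic (with respect to $\nu$), then $$\nu\left(\left\{\omega\in\Omega:\int_\Omega f_1\,d\nu\le\lim_n\frac1n\sum_{k=1}^n f_k(\omega)\le\int_\Omega f_1\,d\bar\nu\right\}\right)=1 .$$
   Context: A capacity is a set function $\nu:\mathcal F\to[0,1]$ with $\nu(\emptyset)=0$, $\nu(\Omega)=1$, and $\nu(A)\le\nu(B)$ whenever $A\subseteq B$. It is convex if $\nu(A\cup B)+\nu(A\cap B)\ge\nu(A)+\nu(B)$ for all $A,B\in\mathcal F$, and continuous at $\Omega$ if $\nu(A_n)\to1$ whenever $A_n\uparrow\Omega$. Its conjugate is $\bar\nu(A)=1-\nu(A^c)$. $\mathbf f$ is stationary if for each $n\in\mathbb N=\{1,2,\dots\}$, each integer $k\ge0$ and each Borel set $B\subseteq\mathbb R^{k+1}$, $\nu(\{\omega:(f_n(\omega),\dots,f_{n+k}(\omega))\in B\})=\nu(\{\omega:(f_{n+1}(\omega),\dots,f_{n+k+1}(\omega))\in B\})$. Let $\sigma(\mathcal C)$ be the $\sigma$-algebra on $\mathbb R^{\mathbb N}$ generated by the cylinders, let $\mathbf f:\Omega\to\mathbb R^{\mathbb N}$ also denote the map $\omega\mapsto(f_1(\omega),f_2(\omega),\dots)$, and let $\nu_{\mathbf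 f}(C)=\nu(\mathbf f^{-1}(C))$ for $C\in\sigma(\mathcal C)$. Let $\tau(x_1,x_2,\dots)=(x_2,x_3,\dots)$ be the shift on $\mathbb R^{\mathbb N}$. $\mathbf f$ is ergodic if $\nu_{\mathbf f}$ is ergodic for the shift, i.e. $\{\nu_{\mathbf f}(C):C\in\sigma(\mathcal C),\ \tau^{-1}(C)=C\}=\{0,1\}$. The Choquet integral of a bounded measurable $f$ with respect to a capacity $\nu$ is $\int_\Omega f\,d\nu=\int_0^\infty\nu(\{f\ge t\})\,dt+\int_{-\infty}^0[\nu(\{f\ge t\})-\nu(\Omega)]\,dt$. In sets whose description involves a limit, membership of $\omega$ includes existence of the limit at $\omega$. *)

(* Defs.v *)
From mathcomp Require Import all_boot all_order all_algebra.
From mathcomp Require Import all_classical all_reals all_analysis.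

Set Implicit Arguments.
Unset Strict Implicit.
Unset Printing Implicit Defensive.

Import Order.TTheory GRing.Theory Num.Theory.
Import numFieldNormedType.Exports.

Local Open Scope classical_set_scope.
Local Open Scope ring_scope.

(* Set functions are total on [set T]; every condition below evaluates them
   only at measurable sets, so the values elsewhere are irrelevant. *)

Record is_capacity (d : measure_display) (T : measurableType d) (R : realType)
    (nu : set T -> R) : Prop := IsCapacity {
  capacity_range : forall A, measurable A -> 0 <= nu A <= 1;
  capacity_set0 : nu set0 = 0;
  capacity_setT : nu setT = 1;
  capacity_le : forall A B, measurable A -> measurable B ->
    A `<=` B -> nu A <= nu B }.

Definition convex_capacity (d : measure_display) (T : measurableType d)
    (R : realType) (nu : set T -> R) : Prop :=
  forall A B, measurable A -> measurable B ->
    nu A + nu B <= nu (A `|` B) + nu (A `&` B).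

Definition continuous_at_setT (d : measure_display) (T : measurableType d)
    (R : realType) (nu : set T -> R) : Prop :=
  forall A : nat -> set T, (forall n, measurable (A n)) ->
    (forall n, A n `<=` A n.+1) -> \bigcup_n A n = setT ->
    nu (A n) @[n --> \oo] --> (1 : R).

Definition conjugate (T : Type) (R : realType) (nu : set T -> R) : set T -> R :=
  fun A => 1 - nu (~` A).

(* For [f] bounded and measurable and [nu] monotone the integrands are monotone
   in [t] and vanish outside a bounded interval, so both integrals are finite. *)
Definition choquet (T : Type) (R : realType) (nu : set T -> R) (f : T -> R) : R :=
  \int[lebesgue_measure]_(t in `[0, +oo[) nu [set w | t <= f w]
  + \int[lebesgue_measure]_(t in `]-oo, 0]) (nu [set w | t <= f w] - nu setT).

(* Sequences indexed by {1, 2, ...} are indexed by [nat] here: [f n] is the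
   term of rank n + 1, and [f 0] the first one. *)

(* The sigma-algebra of [k.+1.-tuple R] is the product of the Borel
   sigma-algebras of [R], i.e. the Borel sigma-algebra of R^(k+1). *)
Definition stationary (d : measure_display) (T : measurableType d)
    (R : realType) (nu : set T -> R) (f : nat -> T -> R) : Prop :=
  forall (n k : nat) (B : set (k.+1.-tuple R)), measurable B ->
    nu [set w | B [tuple f (n + i)%N w | i < k.+1]] =
    nu [set w | B [tuple f (n.+1 + i)%N w | i < k.+1]].

Definition cylinders (R : realType) : set (set (nat -> R)) :=
  [set C : set (nat -> R) | exists (k : nat) (B : set (k.+1.-tuple R)), measurable B /\
    C = [set x : nat -> R | B [tuple x i | i < k.+1]]].

Definition tau (R : realType) (x : nat -> R) : nat -> R := fun n => x n.+1.

Definition law (T : Type) (R : realType) (nu : set T -> R) (f : nat -> T -> R) :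
    set (nat -> R) -> R :=
  fun C => nu ((fun w n => f n w) @^-1` C).

Definition shift_ergodic (R : realType) (mu : set (nat -> R) -> R) : Prop :=
  [set mu C | C in [set C | <<s @cylinders R >> C /\ @tau R @^-1` C = C]] =
  [set 0; 1].

Definition ergodic (T : Type) (R : realType) (nu : set T -> R)
    (f : nat -> T -> R) : Prop :=
  shift_ergodic (law nu f).

(* Main.v *)
(** A convex capacity continuous at the whole space is continuous along all
    monotone sequences of sets, so by the monotone class theorem stationarity
    on cylinders makes the law of the process invariant under the shift.

    Convexity also gives [sum_i mu (A i) <= sum_j mu {at least j of the A i}].
    Applied to the visits of an orbit to a set, this is a Markov inequality for
    the conjugate capacity, which turns the pathwise Katznelson-Weiss estimate
    into: for large [L], the average over [0, L] exceeds its limsup minus [e]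
    on a set of capacity close to 1.  Doing the same for the opposite
    observable, the limsup and the liminf agree almost surely.

    Applied to the level sets of the observable along the orbit, it says that
    the average has level sets whose capacities sum up to at least the Choquet
    integral; by ergodicity the event [c <= liminf] has capacity 0 or 1, and
    capacity 0 is impossible for [c] below the Choquet integral.  The upper
    bound is the lower one for the opposite observable. *)
Require Import Defs.
From mathcomp Require Import all_boot all_order all_algebra.
From mathcomp Require Import all_classical all_reals all_analysis.
From mathcomp Require Import measurable_realfun ring lra zify.

Import Order.TTheory GRing.Theory Num.Theory.
Import numFieldNormedType.Exports.

Set Implicit Arguments.
Unset Strict Implicit.
Unset Printing Implicit Defensive.

Local Open Scope classical_set_scope.
Local Open Scope ring_scope.

(** * Measurability of comparison events *)

Section MeasurableComparison.
Context {R : realType} {d : measure_display} {T : measurableType d}.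
Implicit Types f g : T -> R.

Lemma measurable_set_le f g : measurable_fun setT f -> measurable_fun setT g ->
  measurable [set x | f x <= g x].
Proof.
move=> mf mg.
rewrite (_ : [set x | _] = setT `&` (fun x => g x - f x) @^-1` `[0, +oo[).
  exact: (measurable_funB mg mf).
by rewrite setTI; apply/seteqP; split => x; rewrite /= in_itv/= andbT subr_ge0.
Qed.

Lemma measurable_set_lt f g : measurable_fun setT f -> measurable_fun setT g ->
  measurable [set x | f x < g x].
Proof.
move=> mf mg; rewrite (_ : [set x | _] = ~` [set x | g x <= f x]).
  exact/measurableC/measurable_set_le.
by apply/seteqP; split => x /=; rewrite ltNge => /negP.
Qed.

End MeasurableComparison.

(** * Convex capacities: continuity, events of capacity one, counting of events *)

Definition hits (T I : Type) (r : seq I) (A : I -> set T) (x : T) : nat :=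
  \sum_(i <- r) (x \in A i).

Section Capacity.
Context {R : realType} {d : measure_display} {T : measurableType d}.
Variable mu : set T -> R.
Hypothesis mu_cap : is_capacity mu.
Hypothesis mu_convex : convex_capacity mu.
Hypothesis mu_cont : continuous_at_setT mu.

Lemma capacity_ge0 A : measurable A -> 0 <= mu A.
Proof. by case/(capacity_range mu_cap)/andP. Qed.

Lemma capacity_le1 A : measurable A -> mu A <= 1.
Proof. by case/(capacity_range mu_cap)/andP. Qed.

(* Convexity applied to [A] and [A n `|` ~` A], whose union is everything,
   reduces continuity from below at [A] to continuity at the whole space. *)
Lemma capacity_cvg_bigcup (A : nat -> set T) : (forall n, measurable (A n)) ->
  (forall n, A n `<=` A n.+1) -> mu (A n) @[n --> \oo] --> mu (\bigcup_n A n).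
Proof.
move=> mA ndA; set B := \bigcup_n A n.
have mB : measurable B by exact: bigcup_measurable.
have mAB n : measurable (A n `|` ~` B) by apply: measurableU => //; exact: measurableC.
have AB n : A n `<=` B by exact: bigcup_sup.
have lim1 : mu (A n `|` ~` B) @[n --> \oo] --> (1 : R).
  apply: mu_cont => //; first by move=> n; exact/setSU/ndA.
  by rewrite bigcupUl// setUCr.
have e : 1 + mu B - 1 = mu B by ring.
have lim2 : mu (A n `|` ~` B) + mu B - 1 @[n --> \oo] --> 1 + mu B - 1.
  by apply: cvgB; [apply: cvgD => //|]; exact: cvg_cst.
rewrite e in lim2.
apply: (squeeze_cvgr _ lim2 (cvg_cst _)); apply: nearW => n.
rewrite (capacity_le mu_cap)// andbT lerBlDr.
have := mu_convex (mAB n) mB.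
rewrite setUAC -setUA setUCr setUT (capacity_setT mu_cap).
rewrite setIUl [~` B `&` B]setIC setICr setU0 (setIidl (AB n)); lra.
Qed.

(** The union of [B] with the complement of [A n] increases to the whole space. Convexity, applied
    to this union and [A n], whose intersection is [B], bounds [mu (A n)] above by a sequence
    tending to [mu B]. *)
Lemma capacity_cvg_bigcap (A : nat -> set T) : (forall n, measurable (A n)) ->
  (forall n, A n.+1 `<=` A n) -> mu (A n) @[n --> \oo] --> mu (\bigcap_n A n).
Proof.
move=> mA niA; set B := \bigcap_n A n.
have mB : measurable B by exact: bigcap_measurable.
have mAC n : measurable (~` A n) by exact: measurableC.
have mAB n : measurable (~` A n `|` B) by exact: measurableU.
have BA n : B `<=` A n by exact: bigcap_inf.
have lim1 : mu (~` A n `|` B) @[n --> \oo] --> (1 : R).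
  apply: mu_cont => //; first by move=> n; apply: setSU; exact: subsetC.
  by rewrite bigcupUl// -setC_bigcap setUC setUCr.
have lim2 : 1 + mu B - mu (~` A n `|` B) @[n --> \oo] --> 1 + mu B - 1.
  by apply: cvgB => //; exact: cvg_cst.
rewrite (_ : 1 + mu B - 1 = mu B) in lim2; last by ring.
apply: (squeeze_cvgr _ (cvg_cst _) lim2); apply: nearW => n.
rewrite (capacity_le mu_cap)//= lerBrDr.
have := mu_convex (mA n) (mAB n).
by rewrite setUA setUCr setTU (capacity_setT mu_cap) setIUr setICr set0U (setIidr (BA n)).
Qed.

Lemma capacity_setI1 A B : measurable A -> measurable B ->
  mu A = 1 -> mu B = 1 -> mu (A `&` B) = 1.
Proof.
move=> mA mB A1 B1; have := mu_convex mA mB; rewrite A1 B1.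
have := capacity_le1 (measurableU _ _ mA mB).
have := capacity_le1 (measurableI _ _ mA mB); lra.
Qed.

Lemma capacity_eq1 A : measurable A -> (forall e, 0 < e -> 1 - e <= mu A) -> mu A = 1.
Proof.
move=> mA h; apply/eqP; rewrite eq_le capacity_le1//=.
by apply/ler_addgt0Pr => e e0; rewrite -lerBlDr h.
Qed.

Lemma capacity_le1S A B : measurable A -> measurable B -> A `<=` B ->
  mu A = 1 -> mu B = 1.
Proof.
move=> mA mB AB A1; apply/eqP; rewrite eq_le capacity_le1//= -A1.
exact: (capacity_le mu_cap).
Qed.

Lemma capacity_bigcap1 (A : nat -> set T) : (forall n, measurable (A n)) ->
  (forall n, mu (A n) = 1) -> mu (\bigcap_n A n) = 1.
Proof.
move=> mA A1; pose B n := \big[setI/setT]_(i < n) A i.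
have mB n : measurable (B n) by exact: bigsetI_measurable.
have B1 n : mu (B n) = 1.
  elim: n => [|n IH]; rewrite /B; first by rewrite big_ord0 (capacity_setT mu_cap).
  by rewrite big_ord_recr/=; apply: capacity_setI1 => //; exact: mB.
have := @capacity_cvg_bigcap B mB.
rewrite (_ : \bigcap_n B n = \bigcap_n A n); last first.
  apply/seteqP; split => x /= Bx n _; last first.
    by rewrite /B -bigcap_mkord => i /= _; exact: Bx.
  by have := Bx n.+1 I; rewrite /B big_ord_recr/= => -[].
have -> : (fun n => mu (B n)) = cst 1 by apply/funext => n; rewrite B1.
have niB n : B n.+1 `<=` B n by rewrite /B big_ord_recr/=; exact: subIsetl.
by move=> /(_ niB) /cvg_lim <- //; rewrite lim_cst.
Qed.

Lemma capacity_inhabited : exists _ : T, True.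
Proof.
have [//|T0] := pselect (exists _ : T, True).
have := capacity_setT mu_cap; rewrite (_ : setT = set0).
  by rewrite (capacity_set0 mu_cap) => /eqP; rewrite eq_sym oner_eq0.
by apply/seteqP; split => // x _; apply: T0; exists x.
Qed.

(** The event is the countable intersection of those with slack [1/(k+1)], so an inequality may be
    proved up to an arbitrary [e]. *)
Lemma capacity_set_le1 (f g : T -> R) :
  measurable_fun setT f -> measurable_fun setT g ->
  (forall e, 0 < e -> mu [set x | f x - e <= g x] = 1) ->
  mu [set x | f x <= g x] = 1.
Proof.
move=> mf mg h.
rewrite (_ : [set x | _] = \bigcap_k [set x | f x - k.+1%:R^-1 <= g x]); last first.
  apply/seteqP; split => [x /= fg k _ /=|x /= fg].
    by apply: le_trans fg; rewrite lerBlDr lerDl invr_ge0.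
  apply/ler_addgt0Pr => e e0; rewrite -lerBlDr.
  have := fg (Num.truncn e^-1) I; apply: le_trans; rewrite lerD2l lerN2.
  rewrite -[leRHS]invrK lef_pV2 ?posrE ?invr_gt0//.
  exact/ltW/truncnS_gt.
apply: capacity_bigcap1 => k; last by apply: h; rewrite invr_gt0.
by apply: measurable_set_le => //; exact: measurable_funB.
Qed.

(** A convex capacity need not be subadditive, so the second event is measured by the conjugate.
    Convexity is applied to the union and the complement of [B], whose intersection lies in [A]. *)
Lemma capacity_setU_le A B : measurable A -> measurable B ->
  mu (A `|` B) <= mu A + (1 - mu (~` B)).
Proof.
move=> mA mB; have mAB := measurableU _ _ mA mB.
have := mu_convex mAB (measurableC mB).
rewrite -setUA setUCr setUT (capacity_setT mu_cap).
have : mu ((A `|` B) `&` ~` B) <= mu A.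
  apply: (capacity_le mu_cap) => //; first exact/measurableI/measurableC.
  by move=> x [[]].
lra.
Qed.

Lemma measurable_hits (I : Type) (r : seq I) (A : I -> set T) (p : nat) :
  (forall i, measurable (A i)) -> measurable [set x | (p <= hits r A x)%N].
Proof.
move=> mA; elim: r p => [|i r IH] p.
  rewrite /hits; under eq_set do rewrite big_nil.
  by case: p => [|p]; [rewrite (_ : [set _ | _] = setT)//|
    rewrite (_ : [set _ | _] = set0)//]; apply/seteqP; split.
rewrite (_ : [set _ | _] = [set x | (p <= hits r A x)%N] `|`
    (A i `&` [set x | (p.-1 <= hits r A x)%N])).
  by apply: measurableU => //; exact: measurableI.
apply/seteqP; split => x /=; rewrite /hits big_cons.
  have [xA|xA] := boolP (x \in A i); last by rewrite add0n; left.
  by move=> ?; right; split; [exact/set_mem|lia].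
by case=> [|[/mem_set ->]]; lia.
Qed.

(* The discrete form of superadditivity of the Choquet integral: the right-hand
   side is the integral of the sum of the indicators of the [A i]. *)
Lemma sum_capacity_le_hits (I : Type) (r : seq I) (A : I -> set T) :
  (forall i, measurable (A i)) ->
  \sum_(i <- r) mu (A i) <=
  \sum_(j < size r) mu [set x | (j < hits r A x)%N].
Proof.
move=> mA; elim: r => [|i r IH]; first by rewrite big_nil big_ord0.
have mH s p := measurable_hits s p mA.
rewrite big_cons; pose C j := [set x | (j <= hits r A x)%N].
pose n := size r.
(* Convexity for [C j.+1] and the part of [C j] in [A i]: the union is the event of more than [j]
   hits in [i :: r], the intersection is the part of [C j.+1] in [A i]. *)
have step (j : nat) : mu (C j.+1) + mu (C j `&` A i) <=
    mu [set x | (j < hits (i :: r) A x)%N] + mu (C j.+1 `&` A i).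
  have := mu_convex (mH r j.+1) (measurableI _ _ (mH r j) (mA i)).
  congr (_ <= _ + _).
    congr mu; apply/seteqP; split => x; rewrite /C/= /hits big_cons.
      by case=> [|[h /mem_set ->]]; lia.
    have [xA|xA] := boolP (x \in A i); last by left; lia.
    by move=> h; right; split; [lia|exact/set_mem].
  by congr mu; apply/seteqP; split => x; rewrite /C/=; [case=> ? []|case=> h ?; split=> //; split=> //; lia].
have hmax x : (hits r A x <= n)%N.
  rewrite /n /hits; elim: (r) => [|k s IHs]; first by rewrite big_nil.
  by rewrite big_cons/=; case: (_ \in _); lia.
have Cn : C n.+1 = set0.
  by apply/seteqP; split => x //=; rewrite /C/= => h; have := hmax x; lia.
have C0 : C 0%N = setT by apply/seteqP; split.
have tele (u : nat -> R) p : \sum_(j < p.+1) (u j - u j.+1) = u 0%N - u p.+1.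
  by elim: p => [|m IHm]; [rewrite big_ord1|rewrite big_ord_recr/= IHm; ring].
(* The intersection terms telescope from [mu (A i)] at level 0 to [mu set0] at level [n.+1]. *)
have sumstep : \sum_(j < n.+1) mu (C j.+1) + mu (A i) <=
    \sum_(j < n.+1) mu [set x | (j < hits (i :: r) A x)%N].
  have := tele (fun j => mu (C j `&` A i)) n.
  rewrite Cn C0 set0I setTI (capacity_set0 mu_cap) subr0 => <-.
  by rewrite -big_split/=; apply: ler_sum => j _; have := step j; lra.
apply: le_trans sumstep.
rewrite big_ord_recr/= Cn (capacity_set0 mu_cap) addr0 addrC lerD2r.
exact: IH.
Qed.

End Capacity.

(** * Riemann sums of nonincreasing functions *)

Section RiemannSums.
Context {R : realType}.
Notation leb := (@lebesgue_measure R).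

Lemma nonincreasing_integrable (u : R -> R) (a b : R) : nonincreasing_fun u ->
  leb.-integrable `[a, b[ (EFin \o u).
Proof.
move=> u_ni.
have lty : (leb (`[a, b[ : set R) < +oo)%E.
  by rewrite lebesgue_measure_itv/=; case: ifP => // _; rewrite -EFinD ltry.
apply: measurable_bounded_integrable => //.
  by apply: nonincreasing_measurable.
exists (Num.max `|u a| `|u b|); split; first exact: num_real.
move=> x xM y /=; rewrite in_itv/= => /andP[ay yb].
have := u_ni _ _ ay; have := u_ni _ _ (ltW yb).
move: xM; rewrite gt_max !ltr_norml ler_norml => /andP[/andP[? ?] /andP[? ?]] ? ?.
by apply/andP; split; lra.
Qed.

Variable u : R -> R.
Hypothesis u_ni : nonincreasing_fun u.

Lemma Rintegral_nonincreasing_setU (a b c : R) : a <= b -> b <= c ->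
  \int[leb]_(t in `[a, c[) u t =
  \int[leb]_(t in `[a, b[) u t + \int[leb]_(t in `[b, c[) u t.
Proof.
move=> ab bc.
have E : `[a, c[%classic = `[a, b[%classic `|` `[b, c[%classic :> set R.
  by rewrite -itv_bndbnd_setU// bnd_simp.
rewrite E Rintegral_setU//=; first by rewrite -E; exact: nonincreasing_integrable.
apply/disj_setPS => y [/=]; rewrite !in_itv/= => /andP[_ yb] /andP[].
by rewrite leNgt yb.
Qed.

Lemma Rintegral_nonincreasing_step (a h : R) : 0 <= h ->
  h * u (a + h) <= \int[leb]_(t in `[a, a + h[) u t <= h * u a.
Proof.
move=> h0; have muE : fine (leb (`[a, a + h[ : set R)) = h.
  rewrite lebesgue_measure_itv/= lte_fin ltrDl; have [hp|] := ltP 0 h.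
    by rewrite -EFinD/=; ring.
  by move=> hn; apply/eqP; rewrite eq_le h0 hn.
have icst r : leb.-integrable `[a, a + h[ (EFin \o cst r).
  by apply: nonincreasing_integrable => ? ?.
have cstE r : h * r = \int[leb]_(t in `[a, a + h[) cst r t.
  by rewrite Rintegral_cst// muE mulrC.
rewrite !cstE.
apply/andP; split; apply: le_Rintegral => //; try exact: nonincreasing_integrable.
  by move=> x /=; rewrite in_itv/= => /andP[_ xh]; apply/u_ni/ltW.
by move=> x /=; rewrite in_itv/= => /andP[ax _]; exact: u_ni.
Qed.

Lemma Rintegral_nonincreasing_bounds (a h : R) (n : nat) : 0 <= h ->
  h * \sum_(j < n) u (a + h *+ j.+1) <= \int[leb]_(t in `[a, a + h *+ n[) u t
    <= h * \sum_(j < n) u (a + h *+ j).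
Proof.
move=> h0; elim: n => [|n /andP[IHl IHu]].
  by rewrite !big_ord0 mulr0 addr0 set_itv_ge ?bnd_simp ?ltxx// Rintegral_set0 lexx.
rewrite !big_ord_recr/= !mulrDr.
rewrite (@Rintegral_nonincreasing_setU a (a + h *+ n) (a + h *+ n.+1)).
- have := Rintegral_nonincreasing_step (a + h *+ n) h0.
  by rewrite mulrSr addrA => /andP[? ?]; rewrite !lerD.
- by rewrite lerDl mulrn_wge0.
- by rewrite lerD2l mulrSr lerDl.
Qed.

End RiemannSums.

(** * Approximation of the Choquet integral by sums of capacities; conjugation *)

Section ChoquetSums.
Context {R : realType} {d : measure_display} {T : measurableType d}.
Notation leb := (@lebesgue_measure R).

Section Capacity.
Variables (mu : set T -> R) (f : T -> R) (M : R).
Hypothesis mu_cap : is_capacity mu.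
Hypothesis mf : measurable_fun setT f.
Hypothesis M0 : 0 < M.
Hypothesis fM : forall x, `|f x| < M.

Lemma measurable_level (t : R) : measurable [set w | t <= f w].
Proof. by apply: measurable_set_le. Qed.

Lemma capacity_level_ni : nonincreasing_fun (fun t => mu [set w | t <= f w]).
Proof.
move=> s t st; apply: (capacity_le mu_cap); try exact: measurable_level.
by move=> x /=; exact: le_trans.
Qed.

(** The level sets are everything up to [- M] and empty from [M] on, so both half-lines truncate;
    the constant 1 subtracted on the negative side accounts for the term [- M]. *)
Lemma choquetE :
  choquet mu f = \int[leb]_(t in `[- M, M[) mu [set w | t <= f w] - M.
Proof.
pose u t := mu [set w | t <= f w].
have u_ni : nonincreasing_fun u := capacity_level_ni.
have uM t : M <= t -> u t = 0.
  move=> Mt; rewrite /u (_ : [set w | _] = set0) ?(capacity_set0 mu_cap)//.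
  by apply/seteqP; split => w //=; have := fM w; rewrite ltr_norml => /andP[]; lra.
have uNM t : t <= - M -> u t = 1.
  move=> Mt; rewrite /u (_ : [set w | _] = setT) ?(capacity_setT mu_cap)//.
  by apply/seteqP; split => w //= _; have := fM w; rewrite ltr_norml => /andP[]; lra.
have -> : choquet mu f = \int[leb]_(t in `[0, M[) u t
   + \int[leb]_(t in `[- M, 0]) (u t - 1).
  rewrite /choquet (capacity_setT mu_cap) ; congr (_ + _).
    rewrite Rintegral_mkcond [RHS]Rintegral_mkcond; congr Rintegral.
    apply/funext => t; rewrite !patchE !mem_setE !in_itv/= andbT.
    by case: (leP 0 t) => //= _; case: ltP => // /uM.
  rewrite Rintegral_mkcond [RHS]Rintegral_mkcond; congr Rintegral.
  apply/funext => t; rewrite !patchE !mem_setE !in_itv/=.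
  case: (leP t 0) => [t0|]; rewrite ?andbF// andbT.
  by case: leP => // /ltW /uNM; rewrite /u => ->; rewrite subrr.
have i1 (a b : R) : leb.-integrable `[a, b[ (EFin \o cst 1).
  by apply: nonincreasing_integrable => x y _.
have iu1 : leb.-integrable `[- M, 0[ (EFin \o (fun t => u t - 1)).
  by apply: nonincreasing_integrable => x y xy; rewrite lerD2r u_ni.
rewrite -Rintegral_itv_bndo_bndc// RintegralB//; last exact: nonincreasing_integrable.
have -> : \int[leb]_(t in `[- M, 0[) 1 = M.
  have muE : fine (leb (`[- M, 0[ : set R)) = M.
    by rewrite lebesgue_measure_itv/= lte_fin oppr_lt0 M0/= sub0r opprK.
  by rewrite Rintegral_cst// muE mul1r.
rewrite (@Rintegral_nonincreasing_setU _ _ u_ni (- M) 0 M) ?oppr_le0 ?ltW//.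
by rewrite /u; ring.
Qed.

Lemma choquet_bounds (h : R) (n : nat) : 0 <= h -> h *+ n = M *+ 2 ->
  h * \sum_(j < n) mu [set w | - M + h *+ j.+1 <= f w] - M <= choquet mu f
    <= h * \sum_(j < n) mu [set w | - M + h *+ j <= f w] - M.
Proof.
move=> h0 hn; rewrite choquetE.
have := Rintegral_nonincreasing_bounds capacity_level_ni (- M) n h0.
have -> : - M + h *+ n = M by rewrite hn mulr2n; ring.
by rewrite !lerD2r.
Qed.

End Capacity.

Lemma conjugate_capacity (mu : set T -> R) : is_capacity mu -> is_capacity (conjugate mu).
Proof.
move=> mu_cap; split.
- move=> A mA; rewrite /conjugate.
  by have /andP[] := capacity_range mu_cap (measurableC mA); lra.
- by rewrite /conjugate setC0 (capacity_setT mu_cap) subrr.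
- by rewrite /conjugate setCT (capacity_set0 mu_cap) subr0.
- move=> A B mA mB AB; rewrite /conjugate lerD2l lerN2.
  by apply: (capacity_le mu_cap); [exact: measurableC..|exact: subsetC].
Qed.

(** The complement of [f >= t] lies in [- f >= - t], so a grid sum for [f] and the conjugate is
    compared with one for [- f] and [mu] over the reversed grid, at the cost of one mesh. *)
Lemma oppr_choquet_le_conjugate (mu : set T -> R) (f : T -> R) (M : R) :
  is_capacity mu -> measurable_fun setT f -> (forall x, `|f x| < M) ->
  - choquet mu (fun x => - f x) <= choquet (conjugate mu) f.
Proof.
move=> mu_cap mf fM.
have M0 : 0 < M by have [x _] := capacity_inhabited mu_cap; exact: le_lt_trans (fM x).
have mNf : measurable_fun setT (fun x => - f x) by exact: measurable_funN.
have fM' x : `|- f x| < M by rewrite normrN.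
apply/ler_addgt0Pr => e e0.
pose n := (Num.truncn (2 * M / e)).+1.
have ngt : 2 * M / e < n%:R by exact: truncnS_gt.
pose h := M *+ 2 / n%:R.
have h0 : 0 <= h by rewrite /h divr_ge0// mulrn_wge0// ltW.
have hn : h *+ n = M *+ 2 by rewrite -mulr_natr /h divfK// pnatr_eq0.
have he : h <= e.
  rewrite /h ler_pdivrMr ?ltr0n//; move: ngt; rewrite ltr_pdivrMr//.
  by rewrite [_ * e]mulrC [M *+ 2]mulr2n; lra.
have /andP[+ _] := choquet_bounds (conjugate_capacity mu_cap) mf M0 fM h0 hn.
have /andP[+ _] := choquet_bounds mu_cap mNf M0 fM' h0 hn.
set v := fun t => mu [set w | t <= - f w].
set s1 := \sum_(j < n) _; set s2 := \sum_(j < n) _.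
(* Reversing the grid swaps right endpoints for left ones; the two sums for [v] differ by
   [v (- M) - v M], at most 1. *)
have s2E : n%:R - s1 - 1 <= s2.
  have : \sum_(j < n) (1 - v (- M + h *+ j)) <= s2.
    rewrite (reindex_inj rev_ord_inj) /s2/=; apply: ler_sum => j _.
    rewrite /conjugate lerD2l lerN2 /v; apply: (capacity_le mu_cap).
    - exact/measurableC/measurable_level.
    - exact: measurable_level.
    - move=> w /= /negP; rewrite -ltNge mulrnBr ?ltn_ord// hn mulr2n; lra.
  apply: le_trans; rewrite sumrB sumr_const card_ord.
  have -> : s1 = \sum_(j < n) v (- M + h *+ j.+1) by [].
  have : \sum_(j < n) v (- M + h *+ j) - \sum_(j < n) v (- M + h *+ j.+1) =
      v (- M) - v (- M + h *+ n).
    rewrite -sumrB; elim: (n) => [|m IH]; first by rewrite big_ord0 addr0 subrr.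
    by rewrite big_ord_recr/= IH; ring.
  have := capacity_le1 mu_cap (measurable_level mNf (- M)).
  have := capacity_ge0 mu_cap (measurable_level mNf (- M + h *+ n)).
  by rewrite /v; lra.
have : h * (n%:R - s1 - 1) <= h * s2 by exact: ler_wpM2l.
rewrite 2!mulrBr mulr1 mulr_natr hn mulr2n; lra.
Qed.

End ChoquetSums.

(** * Upper limits of bounded sequences *)

Section LimSup.
Context {R : realType}.
Implicit Types u v : R^nat.

Lemma limn_sup_ltD u (e : R) : bounded_fun u -> 0 < e ->
  exists n, forall m, (n <= m)%N -> u m < limn_sup u + e.
Proof.
move=> bu e0.
have : inf (range (sups u)) < limn_sup u + e by rewrite limn_supE// ltrDl.
case/inf_lt => [|_ [n _ <-] sn]; first by exists (sups u 0%N), 0%N.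
exists n => m nm; apply: le_lt_trans sn.
by apply: ub_le_sup; [exact/has_ubound_sdrop/bounded_fun_has_ubound|exists m].
Qed.

Lemma limn_sup_gtB u (e : R) (n : nat) : bounded_fun u -> 0 < e ->
  exists2 m, (n <= m)%N & limn_sup u - e < u m.
Proof.
move=> bu e0.
have : limn_sup u - e < sups u n.
  rewrite limn_supE// ltrBlDr; apply: (@le_lt_trans _ _ (sups u n)); last by rewrite ltrDl.
  by apply: ge_inf; [exact: bounded_fun_has_lbound_sups|exists n].
by case/sup_gt => [|_ [m /= nm <-] ?]; [exists (u n), n => /=|exists m].
Qed.

(** The condition [n <= m.+1] lets the index drop by one, as needed to compare a sequence with its
    shift. *)
Lemma le_limn_sup u v : bounded_fun u -> bounded_fun v ->
  (forall e, 0 < e -> exists N, forall n, (N <= n)%N ->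
    exists2 m, (n <= m.+1)%N & u n <= v m + e) ->
  limn_sup u <= limn_sup v.
Proof.
move=> bu bv h; apply/ler_addgt0Pr => e e0.
have e3 : 0 < e / 3 by rewrite divr_gt0.
have [N1 hN1] := limn_sup_ltD bv e3.
have [N hN] := h _ e3.
have [n nN un] := limn_sup_gtB (maxn N N1.+1) bu e3.
have [m nm uv] := hN n (leq_trans (leq_maxl _ _) nN).
have : (N1 <= m)%N by rewrite -ltnS; apply: leq_trans nm; apply: leq_trans nN; exact: leq_maxr.
by move/hN1; lra.
Qed.

Lemma limn_sup_shift u v (C : R) : bounded_fun u -> bounded_fun v ->
  (forall n, `|u n.+1 - v n| <= C / n.+1%:R) -> limn_sup u = limn_sup v.
Proof.
move=> bu bv uv.
have C0 : 0 <= C by have := uv 0%N; rewrite divr1; exact: le_trans.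
have small e : 0 < e -> exists N, forall n, (N <= n)%N -> `|u n.+1 - v n| <= e.
  move=> e0; exists (Num.truncn (C / e)) => n Nn; apply: le_trans (uv n) _.
  rewrite ler_pdivrMr ?ltr0n// mulrC -ler_pdivrMr//.
  by apply: le_trans (ltW (truncnS_gt _)) _; rewrite ler_nat ltnS.
apply/eqP; rewrite eq_le; apply/andP; split; apply: le_limn_sup => // e /small[N hN].
  exists N.+1 => -[//|n]; rewrite ltnS => /hN; rewrite ler_norml => /andP[? ?].
  by exists n => //; lra.
exists N => n /hN; rewrite ler_norml => /andP[? ?].
by exists n.+1; [lia|lra].
Qed.

Lemma limn_supN_ltD u (e : R) : bounded_fun u -> 0 < e ->
  exists n, forall m, (n <= m)%N -> - limn_sup (fun k => - u k) - e < u m.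
Proof.
move=> bu e0; have [n hn] := limn_sup_ltD (bounded_funN bu : bounded_fun (fun k => - u k)) e0.
by exists n => m /hn; lra.
Qed.

(** [- limn_sup (fun k => - u k)] is the lower limit; this form lets facts on upper limits be reused
    for the opposite sequence. *)
Lemma limn_sup_cvg u : bounded_fun u ->
  limn_sup u <= - limn_sup (fun k => - u k) -> u @ \oo --> limn_sup u.
Proof.
move=> bu le_su; apply/cvgrPdist_lt => e e0.
have [n1 h1] := limn_sup_ltD bu e0.
have [n2 h2] := limn_supN_ltD bu e0.
exists (maxn n1 n2) => // m /=; rewrite geq_max => /andP[/h1 ? /h2 ?].
by rewrite ltr_norml; apply/andP; split; lra.
Qed.

Lemma limn_sup_bounds u (M : R) : (forall n, `|u n| <= M) -> - M <= limn_sup u <= M.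
Proof.
move=> uM; have bu : bounded_fun u.
  by exists M; split; [exact: num_real|move=> x Mx n _; exact: le_trans (uM n) (ltW Mx)].
apply/andP; split; apply/ler_addgt0Pr => e e0.
  have [n /(_ n (leqnn n))] := limn_sup_ltD bu e0.
  by have := uM n; rewrite ler_norml => /andP[]; lra.
have [n _] := limn_sup_gtB 0 bu e0.
by have := uM n; rewrite ler_norml => /andP[]; lra.
Qed.

End LimSup.

(** * Birkhoff sums along an orbit; the Katznelson-Weiss estimate *)

Section Birkhoff.
Context {R : realType} {T : Type}.
Variable tau : T -> T.
Implicit Types (phi : T -> R) (A : set T).

Definition birkhoff_sum phi (n : nat) (x : T) : R :=
  \sum_(k < n) phi (iter k tau x).

Definition birkhoff_mean phi (n : nat) (x : T) : R :=
  n.+1%:R^-1 * birkhoff_sum phi n.+1 x.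

Definition birkhoff_sup phi (x : T) : R := limn_sup (birkhoff_mean phi ^~ x).

Definition visits A (n : nat) (x : T) : nat :=
  hits (iota 0 n) (fun k => iter k tau @^-1` A) x.

Lemma birkhoff_sumD phi m n x :
  birkhoff_sum phi (m + n) x = birkhoff_sum phi m x + birkhoff_sum phi n (iter m tau x).
Proof.
rewrite /birkhoff_sum big_split_ord/=; congr (_ + _).
by apply: eq_bigr => i _; rewrite -iterD addnC.
Qed.

Lemma visitsD A m n x : visits A (m + n) x = (visits A m x + visits A n (iter m tau x))%N.
Proof.
rewrite /visits /hits iotaD big_cat/=; congr addn.
rewrite add0n -[X in iota X n]addn0 iotaDl big_map; apply: eq_bigr => i _.
by congr (nat_of_bool _); rewrite addnC; apply/idP/idP => /set_mem h;
  apply/mem_set; move: h; rewrite /preimage/= -iterD.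
Qed.

Lemma birkhoff_meanN phi n x :
  birkhoff_mean (fun y => - phi y) n x = - birkhoff_mean phi n x.
Proof. by rewrite /birkhoff_mean /birkhoff_sum sumrN mulrN. Qed.

Section Bounded.
Variables (phi : T -> R) (M : R).
Hypothesis phiM : forall x, `|phi x| <= M.

Lemma birkhoff_sum_le n x : `|birkhoff_sum phi n x| <= M * n%:R.
Proof.
apply: le_trans (ler_norm_sum _ _ _) _.
apply: (@le_trans _ _ (\sum_(k < n) M)); first by apply: ler_sum.
by rewrite sumr_const card_ord mulr_natr.
Qed.

Lemma birkhoff_mean_le n x : `|birkhoff_mean phi n x| <= M.
Proof.
rewrite /birkhoff_mean normrM normfV normr_nat mulrC ler_pdivrMr ?ltr0n//.
exact: birkhoff_sum_le.
Qed.

Lemma birkhoff_mean_bounded x : bounded_fun (birkhoff_mean phi ^~ x).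
Proof.
exists M; split; first exact: num_real.
by move=> y My n _; apply: le_trans (birkhoff_mean_le n x) (ltW My).
Qed.

Lemma birkhoff_sup_bounds x : - M <= birkhoff_sup phi x <= M.
Proof. by apply: limn_sup_bounds => n; exact: birkhoff_mean_le. Qed.

(** [n.+1] times the difference between the mean of [n.+2] terms at [x] and that of [n.+1] terms at
    [tau x] is [phi x] minus the former mean, hence at most [2 * M] in absolute value. *)
Lemma birkhoff_sup_tau x : birkhoff_sup phi (tau x) = birkhoff_sup phi x.
Proof.
apply/esym; apply: (@limn_sup_shift _ _ _ (2 * M)); try exact: birkhoff_mean_bounded.
move=> n; have n0 : 0 < n.+1%:R :> R by rewrite ltr0n.
have n1 : n.+2%:R = n.+1%:R + 1 :> R by rewrite -natr1.
have : birkhoff_sum phi n.+2 x = phi x + birkhoff_sum phi n.+1 (tau x).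
  by rewrite -(add1n n.+1) birkhoff_sumD {1}/birkhoff_sum big_ord1.
have := birkhoff_mean_le n.+1 x; rewrite /birkhoff_mean.
set a := birkhoff_sum phi n.+2 x; set b := birkhoff_sum phi n.+1 (tau x) => aM ab.
have E : (n.+2%:R^-1 * a - n.+1%:R^-1 * b) * n.+1%:R = phi x - n.+2%:R^-1 * a.
  have b' : n.+1%:R^-1 * b * n.+1%:R = b by rewrite mulrAC mulVf ?mul1r// pnatr_eq0.
  have : n.+2%:R^-1 * a * n.+2%:R = a by rewrite mulrAC mulVf ?mul1r// pnatr_eq0.
  rewrite mulrBl b' {2}n1 mulrDr mulr1; set c := n.+2%:R^-1 * a; set c' := c * _.
  by move=> a'; lra.
rewrite ler_pdivlMr// -[X in _ * X <= _](gtr0_norm n0) -normrM E.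
by apply: le_trans (ler_normB _ _) _; have := phiM x; lra.
Qed.

Lemma birkhoff_sup_iter n x : birkhoff_sup phi (iter n tau x) = birkhoff_sup phi x.
Proof. by elim: n => //= n IH; rewrite birkhoff_sup_tau. Qed.

(** The bad set of the block decomposition: from such a point no block of length at most [N] has a
    good average. *)
Definition late_start (e : R) (N : nat) : set T :=
  [set x | forall m, (m < N)%N -> birkhoff_mean phi m x <= birkhoff_sup phi x - e].

Lemma late_start_le e N : late_start e N.+1 `<=` late_start e N.
Proof. by move=> x h m mN; apply: h; exact: ltnW. Qed.

Lemma bigcup_late_startC e : 0 < e -> \bigcup_N ~` late_start e N = setT.
Proof.
move=> e0; apply/seteqP; split => // x _.
have [m _ um] := limn_sup_gtB 0 (birkhoff_mean_bounded x) e0.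
exists m.+1 => //= /(_ m (ltnSn m)); rewrite leNgt => /negP; exact.
Qed.

(* Katznelson-Weiss: cut the orbit segment greedily into blocks of length at
   most [N] on which the average is above [birkhoff_sup phi x - e], skipping
   one step at each visit to [late_start e N]. *)
Lemma birkhoff_sum_ge (e : R) (N L : nat) x : 0 <= e ->
  L%:R * (birkhoff_sup phi x - e) - 2 * M * (visits (late_start e N) L x)%:R
    - 2 * M * N%:R <= birkhoff_sum phi L x.
Proof.
move=> e0; have M0 : 0 <= M by apply: le_trans (phiM x).
elim/ltn_ind: L x => L IH x.
have /andP[FM FM'] := birkhoff_sup_bounds x.
have := birkhoff_sum_le L x; rewrite ler_norml => /andP[SM _].
(* When at most [N] steps are left, bounding each crudely by [M] costs at most [2 * M * N], the last
   error term. *)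
have [LN|NL] := leqP L N.
  apply: le_trans SM.
  have v0 : 0 <= 2 * M * (visits (late_start e N) L x)%:R by rewrite !mulr_ge0.
  have : M * L%:R <= M * N%:R by rewrite ler_wpM2l// ler_nat.
  have : L%:R * (birkhoff_sup phi x - e) <= L%:R * M by rewrite ler_wpM2l//; lra.
  lra.
(* Splits off a first block satisfying the bound without the tail term; the rest goes by induction,
   with the same target since [birkhoff_sup] is invariant. *)
have block m : (0 < m <= L)%N ->
    m%:R * (birkhoff_sup phi x - e) - 2 * M * (visits (late_start e N) m x)%:R
      <= birkhoff_sum phi m x ->
    L%:R * (birkhoff_sup phi x - e) - 2 * M * (visits (late_start e N) L x)%:R
      - 2 * M * N%:R <= birkhoff_sum phi L x.
  move=> /andP[m0 mL]; have Lm : (L - m < L)%N by rewrite ltn_subrL m0 (leq_trans m0 mL).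
  have := IH _ Lm (iter m tau x); rewrite birkhoff_sup_iter.
  have EL : L%:R = m%:R + (L - m)%:R :> R by rewrite -natrD subnKC.
  have := birkhoff_sumD phi m (L - m) x; rewrite subnKC// => ->.
  have := visitsD (late_start e N) m (L - m) x; rewrite subnKC// => ->.
  by rewrite EL natrD; lra.
have L0 : (0 < L)%N by exact: leq_trans NL.
(* A bad point forms a block of length 1, its loss of at most [2 * M] being paid by the visit. *)
have [xA|] := pselect (late_start e N x).
  apply: (block 1%N) => //; rewrite /visits /hits/= big_seq1 mem_set// mulr1 mul1r.
  rewrite /birkhoff_sum big_ord1/=.
  by have := phiM x; rewrite ler_norml => /andP[]; lra.
move=> /existsNP[m /not_implyP[mN /negP]]; rewrite -ltNge => Fm.
apply: (block m.+1); first by rewrite /= (leq_trans mN (ltnW NL)).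
have v0 : 0 <= 2 * M * (visits (late_start e N) m.+1 x)%:R by rewrite !mulr_ge0.
have : m.+1%:R * (birkhoff_sup phi x - e) <= birkhoff_sum phi m.+1 x.
  rewrite mulrC -ler_pdivlMr ?ltr0n//; move: Fm; rewrite /birkhoff_mean mulrC.
  exact: ltW.
lra.
Qed.

End Bounded.
End Birkhoff.

(** * The ergodic theorem for an invariant convex capacity *)

Lemma sum_ltn_le (m q : nat) : (\sum_(l < m) (l < q) <= q)%N.
Proof.
suff : (\sum_(l < m) (l < q) <= minn m q)%N by lia.
elim: m => [|m]; first by rewrite big_ord0.
by rewrite big_ord_recr/=; move: (\sum_(l < m) _)%N => s; case: (ltnP m q); lia.
Qed.

Section InvariantCapacity.
Context {R : realType} {d : measure_display} {T : measurableType d}.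
Variables (mu : set T -> R) (tau : T -> T).
Hypothesis mu_cap : is_capacity mu.
Hypothesis mu_convex : convex_capacity mu.
Hypothesis mu_cont : continuous_at_setT mu.
Hypothesis mtau : measurable_fun setT tau.
Hypothesis mu_inv : forall A, measurable A -> mu (tau @^-1` A) = mu A.

Lemma measurable_iter k : measurable_fun setT (iter k tau).
Proof.
elim: k => [|k IH]; first exact: measurable_id.
exact: (measurableT_comp mtau IH).
Qed.

Lemma measurable_iter_preimage k A : measurable A -> measurable (iter k tau @^-1` A).
Proof. by move=> mA; rewrite -[_ @^-1` _]setTI; exact: measurable_iter. Qed.

Lemma capacity_iter_preimage k A : measurable A -> mu (iter k tau @^-1` A) = mu A.
Proof.
move=> mA; elim: k => // k <-; rewrite -[RHS]mu_inv; last exact: measurable_iter_preimage.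
by congr mu; apply/funext => x; rewrite /preimage/= -iterSr.
Qed.

Lemma measurable_visits A L p : measurable A ->
  measurable [set x | (p <= visits tau A L x)%N].
Proof. by move=> mA; apply: measurable_hits => k; exact: measurable_iter_preimage. Qed.

Lemma visitsC A L x : (visits tau (~` A) L x + visits tau A L x = L)%N.
Proof.
rewrite /visits /hits -big_split/= (eq_bigr (fun=> 1%N)).
  by rewrite big_const_seq count_predT size_iota iter_addn addn0 mul1n.
move=> k _; rewrite [_ @^-1` ~` _](_ : _ = ~` (iter k tau @^-1` A))// in_setC.
by case: (_ \in _).
Qed.

(* Markov's inequality for the number of visits to [A], in terms of the
   conjugate capacity. *)
Lemma capacity_visits_ge A L p : measurable A ->
  p%:R * (1 - mu (~` [set x | (p <= visits tau A L x)%N])) <= L%:R * (1 - mu (~` A)).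
Proof.
move=> mA; set D := [set x | _].
have mD : measurable D by exact: measurable_visits.
have mAC := measurableC mA.
have [pL|Lp] := leqP p L; last first.
  have -> : D = set0.
    by apply/seteqP; split => x //; rewrite /D/=; have := visitsC A L x; lia.
  rewrite setC0 (capacity_setT mu_cap) subrr mulr0 mulr_ge0// subr_ge0.
  exact: (capacity_le1 mu_cap).
have := sum_capacity_le_hits mu_cap mu_convex (iota 0 L)
  (fun k => measurable_iter_preimage k mAC).
rewrite (eq_bigr (fun=> mu (~` A))); last by move=> k _; rewrite capacity_iter_preimage.
rewrite big_const_seq count_predT size_iota iter_addr addr0 -[mu _ *+ _]mulr_natl.
set S := (X in _ <= X) => hS.
(* The first [L - p] levels count for at most 1 each; beyond them, visits to [A] number fewer than
   [p], an event inside the complement of [D]. *)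
suff : S <= (L - p)%:R + p%:R * mu (~` D) by move: hS; rewrite natrB//; lra.
have -> : S = \sum_(j < (L - p) + p)
    mu [set x | (j < visits tau (~` A) L x)%N] by rewrite subnK// size_iota.
rewrite big_split_ord/=; apply: lerD.
  rewrite -[leRHS]mul1r mulr_natr -[X in _ *+ X](card_ord (L - p)) -sumr_const.
  apply: ler_sum => j _; apply: (capacity_le1 mu_cap).
  exact: measurable_visits.
rewrite mulrC mulr_natr -[X in _ *+ X](card_ord p) -sumr_const.
apply: ler_sum => j _; apply: (capacity_le mu_cap); last 1 first.
- move=> x; rewrite /D/=; have := visitsC A L x; lia.
- exact: measurable_visits.
- exact: measurableC.
Qed.

Section Observable.
Variables (phi : T -> R) (M : R).
Hypothesis mphi : measurable_fun setT phi.
Hypothesis phiM : forall x, `|phi x| < M.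

Let phiM' x : `|phi x| <= M. Proof. exact: ltW. Qed.

Lemma measurable_birkhoff_mean n : measurable_fun setT (birkhoff_mean tau phi n).
Proof.
apply: measurable_funM => //; apply: measurable_sum => k.
exact: (measurableT_comp mphi (measurable_iter k)).
Qed.

Lemma measurable_birkhoff_sup : measurable_fun setT (birkhoff_sup tau phi).
Proof.
apply: measurable_fun_limn_sup.
- by move=> x _; exact/bounded_fun_has_ubound/birkhoff_mean_bounded.
- by move=> x _; exact/bounded_fun_has_lbound/birkhoff_mean_bounded.
- exact: measurable_birkhoff_mean.
Qed.

Lemma measurable_late_start e N : measurable (late_start tau phi e N).
Proof.
rewrite (_ : late_start tau phi e N = \bigcap_(m in `I_N)
    [set x | birkhoff_mean tau phi m x <= birkhoff_sup tau phi x - e]); last first.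
  by apply/seteqP; split => x /= h m; exact: h.
apply: bigcap_measurableType => m _; apply: measurable_set_le.
  exact: measurable_birkhoff_mean.
by apply: measurable_funB => //; exact: measurable_birkhoff_sup.
Qed.

(** For [N] large the bad set has small conjugate capacity, so by the Markov inequality an orbit
    segment of length [L.+1] rarely visits it often; the pathwise estimate then applies with three
    errors of [e / 3]. *)
Lemma birkhoff_mean_gt_sup (e eta : R) : 0 < e -> 0 < eta ->
  exists L0, forall L, (L0 <= L)%N ->
    1 - eta <= mu [set x | birkhoff_sup tau phi x - e < birkhoff_mean tau phi L x].
Proof.
move=> e0 eta0.
have M0 : 0 < M by have [x _] := capacity_inhabited mu_cap; exact: le_lt_trans (phiM x).
have e3 : 0 < e / 3 by rewrite divr_gt0.
(* Chosen so that [L.+1 / q] visits lose at most [L.+1 * e / 3], and so that [q * N < L.+1] bounds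
   the tail [2 * M * N] likewise. *)
pose q := 6 * M / e; have q0 : 0 < q by rewrite divr_gt0// mulr_gt0.
pose A := late_start tau phi (e / 3).
have mA N : measurable (A N) := measurable_late_start (e / 3) N.
have : mu (~` A N) @[N --> \oo] --> (1 : R).
  apply: mu_cont; first by move=> N; exact: measurableC.
    by move=> N; apply: subsetC; exact: late_start_le.
  exact: (bigcup_late_startC _ phiM').
have etaq0 : 0 < eta / q by rewrite divr_gt0.
move=> /cvgrPdist_lt /(_ _ etaq0) [N _ /(_ N (leqnn N))] /=.
rewrite ltr_norml => /andP[_ AN].
exists (Num.truncn (q * N%:R)) => L LN.
have qN : q * N%:R < L.+1%:R.
  by apply: lt_le_trans (truncnS_gt _) _; rewrite ler_nat ltnS.
(* Fewer than [p] visits means at most [L.+1 / q], while [p > L.+1 / q] puts the Markov bound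
   [L.+1 * eta / q] below [p * eta]. *)
pose p := (Num.truncn (L.+1%:R / q)).+1.
have pq : L.+1%:R / q < p%:R by exact: truncnS_gt.
have pq' : p.-1%:R <= L.+1%:R / q by rewrite truncn_le// divr_ge0// ltW.
have := capacity_visits_ge L.+1 p (mA N).
set D := [set x | (p <= _)%N] => visit.
have mD : measurable D by exact: measurable_visits.
have : mu (~` D) <= mu [set x | birkhoff_sup tau phi x - e < birkhoff_mean tau phi L x].
  apply: (capacity_le mu_cap); first exact: measurableC.
    apply: measurable_set_lt; last exact: measurable_birkhoff_mean.
    by apply: measurable_funB => //; exact: measurable_birkhoff_sup.
  move=> x; rewrite /D/= => /negP; rewrite -ltnNge => vp.
  rewrite /birkhoff_mean mulrC ltr_pdivlMr ?ltr0n//.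
  apply: lt_le_trans _ (birkhoff_sum_ge tau phiM' N L.+1 x (ltW e3)).
  have v1 : (visits tau (A N) L.+1 x)%:R <= L.+1%:R / q.
    by apply: le_trans pq'; rewrite ler_nat.
  move: v1 qN; rewrite /A /q invf_div; set v := (visits _ _ _ _)%:R.
  rewrite mulrA ler_pdivlMr ?mulr_gt0// => v1.
  rewrite [_ * N%:R]mulrAC ltr_pdivrMr// => N1; lra.
apply: le_trans.
have : p%:R * (1 - mu (~` D)) <= p%:R * eta.
  apply: le_trans visit _; apply: (@le_trans _ _ (L.+1%:R * (eta / q))).
    by apply: ler_wpM2l => //; exact: ltW.
  by rewrite mulrCA mulrC ler_wpM2r ?(ltW eta0)// mulrC ltW// mulrC.
by rewrite ler_pM2l ?ltr0n//; lra.
Qed.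

End Observable.

Section ErgodicTheorem.
Variables (phi : T -> R) (M : R).
Hypothesis mphi : measurable_fun setT phi.
Hypothesis phiM : forall x, `|phi x| < M.

Let F := birkhoff_sup tau phi.
Let Nphi x := - phi x.
Let G x := - birkhoff_sup tau Nphi x.

Let mNphi : measurable_fun setT Nphi.
Proof. exact: measurable_funN. Qed.

Let NphiM x : `|Nphi x| < M.
Proof. by rewrite normrN. Qed.

Let mF : measurable_fun setT F.
Proof. exact: (measurable_birkhoff_sup mphi phiM). Qed.

Let mG : measurable_fun setT G.
Proof. by apply: measurable_funN; exact: (measurable_birkhoff_sup mNphi NphiM). Qed.

Let mmean L : measurable_fun setT (birkhoff_mean tau phi L).
Proof. exact: measurable_birkhoff_mean. Qed.

Let birkhoff_mean_lt_inf (e eta : R) : 0 < e -> 0 < eta ->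
  exists L0, forall L, (L0 <= L)%N ->
    1 - eta <= mu [set x | birkhoff_mean tau phi L x < G x + e].
Proof.
move=> e0 eta0; have [L0 h] := birkhoff_mean_gt_sup mNphi NphiM e0 eta0.
exists L0 => L /h /le_trans; apply; apply: (capacity_le mu_cap).
- apply: measurable_set_lt; last exact: measurable_birkhoff_mean.
  by apply: measurable_funB => //; exact: (measurable_birkhoff_sup mNphi NphiM).
- by apply: measurable_set_lt => //; exact: measurable_funD.
- by move=> x /=; rewrite birkhoff_meanN /G; lra.
Qed.

(** Both one-sided estimates are taken at a common [L]: by convexity they hold together with
    capacity at least [1 - eta], and then the mean is within [e / 2] of exceeding the upper limit
    and of falling below the lower one. *)
Lemma birkhoff_sup_le_inf :
  mu [set x | birkhoff_sup tau phi x <= - birkhoff_sup tau (fun y => - phi y) x] = 1.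
Proof.
apply: (capacity_set_le1 mu_cap mu_convex mu_cont) => // e e0.
have mE : measurable [set x | F x - e <= G x].
  by apply: measurable_set_le => //; exact: measurable_funB.
have e2 : 0 < e / 2 by rewrite divr_gt0.
apply: (capacity_eq1 mu_cap) => // eta eta0.
have eta2 : 0 < eta / 2 by rewrite divr_gt0.
have [L1 h1] := birkhoff_mean_gt_sup mphi phiM e2 eta2.
have [L2 h2] := birkhoff_mean_lt_inf e2 eta2.
pose L := maxn L1 L2.
have := h1 L (leq_maxl _ _); have := h2 L (leq_maxr _ _).
set A := [set x | _ < _ + _]; set B := [set x | _ < _].
have mA : measurable A by apply: measurable_set_lt => //; exact: measurable_funD.
have mB : measurable B by apply: measurable_set_lt => //; exact: measurable_funB.
have mAB := measurableI _ _ mA mB.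
have : mu (A `&` B) <= mu [set x | F x - e <= G x].
  by apply: (capacity_le mu_cap) => // x; rewrite /A /B/= -/(F x) => -[]; lra.
have := mu_convex mA mB; have := capacity_le1 mu_cap (measurableU _ _ mA mB).
lra.
Qed.

Hypothesis mu01 : forall A, measurable A -> tau @^-1` A = A -> mu A = 0 \/ mu A = 1.

Let G_ge1 (c : R) : mu [set x | c <= G x] != 0 -> mu [set x | c <= G x] = 1.
Proof.
case: (@mu01 [set x | c <= G x]) => // [||->]; last by rewrite eqxx.
  exact: measurable_set_le.
by apply/funext => x; rewrite /preimage/= /G (birkhoff_sup_tau tau (fun y => ltW (NphiM y))).
Qed.

(** Up to the factor [h], a discretisation of [phi x + M] by the level sets whose capacities occur
    in [choquet_bounds]. *)
Let levels (h : R) (n : nat) (x : T) : nat := \sum_(j < n) (- M + h *+ j <= phi x)%R.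

Let levels_le (h : R) n x : 0 <= h -> h * (levels h n x)%:R <= phi x + M + h.
Proof.
move=> h0; have := phiM x; rewrite ltr_norml => /andP[phiMx _].
rewrite /levels; elim: n => [|n IH]; first by rewrite big_ord0 mulr0; lra.
rewrite big_ord_recr/=; case: (boolP (- M + h *+ n <= phi x)) => [hn|_]; last by rewrite addn0.
have cn : (\sum_(j < n) (- M + h *+ j <= phi x)%R <= n)%N.
  rewrite -[leqRHS]card_ord -sum1_card; apply: leq_sum => j _.
  by case: (_ <= _).
have : h * (\sum_(j < n) (- M + h *+ j <= phi x)%R + 1)%:R <= h * n.+1%:R.
  by rewrite ler_wpM2l// ler_nat addn1.
by move: hn; rewrite -mulr_natr -natr1 mulrDr mulr1; lra.
Qed.

(** By contradiction: were [c - e <= G] of capacity 0, the mean at some [L] would reach [c - e / 2]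
    only on a small event. The number of hits over all times and levels would then be too low for
    the sum of the capacities, which is at least [L.+1 * (c + M) / h]. *)
Lemma choquet_le_birkhoff_inf :
  mu [set x | choquet mu phi <= - birkhoff_sup tau (fun y => - phi y) x] = 1.
Proof.
apply: (capacity_set_le1 mu_cap mu_convex mu_cont) => // e e0.
set c := choquet mu phi.
have M0 : 0 < M by have [x _] := capacity_inhabited mu_cap; exact: le_lt_trans (phiM x).
(* The lower limit is at least [- M], which settles the first case; in the second,
   [c - e / 2 + M + h] is positive, as the truncation defining [q] requires. *)
have [ceM|ceM] := leP (c - e) (- M).
  rewrite (_ : [set x | _] = setT) ?(capacity_setT mu_cap)//.
  apply/seteqP; split => x //= _; apply: le_trans ceM _.
  by rewrite lerN2; have /andP[] := birkhoff_sup_bounds tau (fun y => ltW (NphiM y)) x.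
apply: G_ge1; apply/eqP => G0.
(* With [eta] below, this leaves a total error [2 * h + eta * (2 * M)] of at most [e / 4], less than
   the slack [e / 2]. *)
pose n := (Num.truncn (32 * M / e)).+1.
have ngt : 32 * M / e < n%:R by exact: truncnS_gt.
pose h := M *+ 2 / n%:R.
have h0 : 0 < h by rewrite /h divr_gt0// pmulrn_lgt0.
have hn : h *+ n = M *+ 2 by rewrite -mulr_natr /h divfK// pnatr_eq0.
have he : h <= e / 16.
  rewrite /h ler_pdivrMr ?ltr0n//; move: ngt; rewrite ltr_pdivrMr//.
  by rewrite [M *+ 2]mulr2n; lra.
pose eta := e / (16 * M).
have eta0 : 0 < eta by rewrite divr_gt0// mulr_gt0.
have e2 : 0 < e / 2 by rewrite divr_gt0.
have [L /(_ L (leqnn L)) meanG] := birkhoff_mean_lt_inf e2 eta0.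
pose B := [set x | c - e / 2 <= birkhoff_mean tau phi L x].
have mB : measurable B by apply: measurable_set_le.
(* A point of [B] has [c - e <= G] or violates the estimate [meanG]; the first event has capacity 0,
   the second conjugate capacity at most [eta]. *)
have B_eta : mu B <= eta.
  set A := [set x | _ < _] in meanG.
  have mA : measurable A by apply: measurable_set_lt => //; exact: measurable_funD.
  have mGe : measurable [set x | c - e <= G x] by exact: measurable_set_le.
  have := capacity_setU_le mu_cap mu_convex mGe (measurableC mA).
  rewrite setCK G0 add0r => le1.
  apply: le_trans (_ : mu ([set x | c - e <= G x] `|` ~` A) <= _); last by lra.
  apply: (capacity_le mu_cap) => //; first exact/measurableU/measurableC.
  move=> x; rewrite /B /A/= => Bx.
  case: (ltP (birkhoff_mean tau phi L x) (G x + e / 2)); first by left; lra.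
  by move=> ?; right.
pose r := [seq (k, j) | k <- iota 0 L.+1, j <- iota 0 n].
pose A (kj : nat * nat) := iter kj.1 tau @^-1` [set x | - M + h *+ kj.2 <= phi x].
have mA kj : measurable (A kj).
  by apply: measurable_iter_preimage; exact: measurable_set_le.
have := sum_capacity_le_hits mu_cap mu_convex r mA.
have hitsE x : hits r A x = \sum_(k < L.+1) levels h n (iter k tau x).
  rewrite /hits /r big_allpairs -[iota 0 L.+1]/(index_iota 0 L.+1) big_mkord.
  apply: eq_bigr => k _; rewrite -[iota 0 n]/(index_iota 0 n) big_mkord.
  by apply: eq_bigr => j _; congr nat_of_bool; apply/idP/idP => [/set_mem|?]//; exact/mem_set.
have hits_le x : h * (hits r A x)%:R <= birkhoff_sum tau phi L.+1 x + L.+1%:R * (M + h).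
  rewrite hitsE natr_sum mulr_sumr mulr_natl -[X in _ *+ X](card_ord L.+1) -sumr_const.
  rewrite /birkhoff_sum -big_split/=; apply: ler_sum => k _.
  by rewrite addrA; exact/levels_le/ltW.
have -> : \sum_(i <- r) mu (A i) = L.+1%:R * \sum_(j < n) mu [set x | - M + h *+ j <= phi x].
  rewrite /r big_allpairs -[iota 0 L.+1]/(index_iota 0 L.+1) big_mkord.
  rewrite mulr_natl -[X in _ *+ X](card_ord L.+1) -sumr_const; apply: eq_bigr => k _.
  rewrite -[iota 0 n]/(index_iota 0 n) big_mkord; apply: eq_bigr => j _.
  by rewrite /A/= capacity_iter_preimage//; exact: measurable_set_le.
rewrite size_allpairs !size_iota.
have /andP[_] := choquet_bounds mu_cap mphi M0 phiM (ltW h0) hn.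
rewrite -/c; set U := \sum_(j < n) _ => cU LU.
have l0_ge0 : 0 <= L.+1%:R * (c - e / 2 + M + h) / h.
  by apply: divr_ge0; [apply: mulr_ge0 => //; lra|exact: ltW].
(* A hit count of at least [q] forces a mean of at least [c - e / 2], since [h] times the count is
   at most the Birkhoff sum plus [L.+1 * (M + h)]. *)
pose q := (Num.truncn (L.+1%:R * (c - e / 2 + M + h) / h)).+1.
have ltq : L.+1%:R * (c - e / 2 + M + h) / h < q%:R by exact: truncnS_gt.
have qle : q%:R <= L.+1%:R * (c - e / 2 + M + h) / h + 1.
  by rewrite /q -natr1 lerD2r truncn_le.
have hit_le (l : nat) : mu [set x | (l < hits r A x)%N] <= (l < q)%N%:R + eta.
  case: (ltnP l q) => [lq|ql].
    by apply: le_trans (capacity_le1 mu_cap (measurable_hits _ _ mA)) _; rewrite lerDl ltW.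
  rewrite add0r; apply: le_trans B_eta; apply: (capacity_le mu_cap) => //.
    exact: measurable_hits.
  move=> x; rewrite /B/= => lx; rewrite /birkhoff_mean [_ * birkhoff_sum _ _ _ _]mulrC ler_pdivlMr ?ltr0n//.
  have : L.+1%:R * (c - e / 2 + M + h) / h <= (hits r A x)%:R.
    by apply: le_trans (ltW ltq) _; rewrite ler_nat; apply: leq_trans ql (ltnW lx).
  by rewrite ler_pdivrMr// mulrC; have := hits_le x; lra.
have : L.+1%:R * U <= q%:R + eta *+ (L.+1 * n).
  apply: le_trans LU _; apply: (@le_trans _ _ (\sum_(l < L.+1 * n) ((l < q)%N%:R + eta))).
    by apply: ler_sum => l _; exact: hit_le.
  rewrite big_split/= sumr_const card_ord lerD2r -natr_sum ler_nat; exact: sum_ltn_le.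
move=> /(ler_wpM2l (ltW h0)).
have : L.+1%:R * (c + M) <= L.+1%:R * (h * U) by rewrite ler_wpM2l//; lra.
have -> : h * (q%:R + eta *+ (L.+1 * n)) = h * q%:R + L.+1%:R * (eta * (h *+ n)).
  by rewrite mulrDr -[eta *+ _]mulr_natr natrM -[h *+ n]mulr_natr; ring.
have -> : eta * (h *+ n) = e / 8.
  by rewrite hn /eta -mulr_natr; field; rewrite gt_eqF.
have : h * q%:R <= L.+1%:R * (c - e / 2 + M + h) + h.
  move: qle => /(ler_wpM2l (ltW h0)); rewrite mulrDr mulr1 mulrCA divff ?gt_eqF//.
  by rewrite mulr1.
have : h <= L.+1%:R * h by apply: ler_peMl; [exact: ltW|rewrite ler1n].
have : L.+1%:R * h <= L.+1%:R * (e / 16) by rewrite ler_wpM2l.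
have : 0 < L.+1%:R * e by rewrite mulr_gt0// ltr0n.
by rewrite [h * (_ * U)]mulrCA; lra.
Qed.

End ErgodicTheorem.
End InvariantCapacity.

(** * Measurability of convergence and of limits *)

Section MeasurableLimit.
Context {R : realType} {d : measure_display} {T : measurableType d}.
Variable g : nat -> T -> R.
Hypothesis mg : forall n, measurable_fun setT (g n).

(** Cauchy's criterion with tolerances [1/(k+1)] and against a single index, so that convergence is
    expressed by countable set operations. *)
Lemma cvgn_cauchyE (u : R^nat) :
  cvgn u <-> forall k, exists n, forall m, (n <= m)%N -> `|u n - u m| <= k.+1%:R^-1.
Proof.
split=> [/cvg_ex[l /cvgrPdist_lt ul] k|h].
  have : 0 < k.+1%:R^-1 :> R by rewrite invr_gt0.
  move: (k.+1%:R^-1) => e e0; have k2 : 0 < e / 2 by rewrite divr_gt0.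
  have [n _ hn] := ul _ k2; exists n => m nm.
  have := hn n (leqnn n); have := hn m nm; rewrite /= !ltr_norml ler_norml.
  by move=> /andP[? ?] /andP[? ?]; apply/andP; split; lra.
apply/cauchy_cvgP/cauchy_exP => e e0.
have [n hn] := h (Num.truncn e^-1); exists (u n); exists n => // m /= nm.
rewrite -ball_normE /=; apply: le_lt_trans (hn m nm) _.
by rewrite -[ltRHS]invrK ltf_pV2 ?posrE ?invr_gt0//; exact: truncnS_gt.
Qed.

Lemma measurable_cvgn : measurable [set w | cvgn (g ^~ w)].
Proof.
rewrite (_ : [set w | _] = \bigcap_k \bigcup_n \bigcap_(m in [set m | (n <= m)%N])
    [set w | `|g n w - g m w| <= k.+1%:R^-1]); last first.
  apply/seteqP; split => w /=.
    by move=> /cvgn_cauchyE h k _; have [n hn] := h k; exists n.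
  by move=> h; apply/cvgn_cauchyE => k; have [n _ hn] := h k I; exists n.
apply: bigcap_measurableType => k _; apply: bigcup_measurable => n _.
apply: bigcap_measurableType => m _; apply: measurable_set_le => //.
by apply: measurableT_comp => //; exact: measurable_funB.
Qed.

Lemma measurable_limn_itv (a b : R) :
  measurable [set w | cvgn (g ^~ w) /\ a <= limn (g ^~ w) <= b].
Proof.
have mC := measurable_cvgn.
have mL : measurable_fun [set w | cvgn (g ^~ w)] (fun w => limn (g ^~ w)).
  by apply: (@measurable_fun_cvg _ _ _ _ g) => // n; exact: measurable_funTS.
rewrite (_ : [set w | _] = [set w | cvgn (g ^~ w)] `&` (fun w => limn (g ^~ w)) @^-1` `[a, b]).
  exact: mL.
by apply/seteqP; split => w /=; rewrite in_itv.
Qed.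

End MeasurableLimit.

(** * Sequence space and the law of the process *)

Section SequenceSpace.
Context {R : realType}.
Let X := g_sigma_algebraType (@cylinders R).

Lemma iter_tau k (x : nat -> R) n : iter k (@tau R) x n = x (n + k)%N.
Proof. by elim: k n => [|k IH] n /=; rewrite ?addn0// /tau IH addSnnS. Qed.

Lemma measurable_coordinate n : measurable_fun setT (fun x : X => x n).
Proof.
move=> _ B mB; rewrite setTI; apply: sub_sigma_algebra.
exists n, [set t : n.+1.-tuple R | B (tnth t ord_max)]; split.
  by rewrite -[X in measurable X]setTI; exact: measurable_tnth.
by apply/seteqP; split => x /=; rewrite tnth_mktuple.
Qed.

Lemma measurable_to_sequence d (T : measurableType d) (g : T -> X) :
  (forall n, measurable_fun setT (fun w => g w n)) -> measurable_fun setT g.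
Proof.
move=> mg; apply: (@measurability _ _ T X setT g (@cylinders R) erefl).
move=> _ [_ [k [B [mB ->]]] <-].
have mt : measurable_fun setT (fun w => [tuple g w i | i < k.+1]).
  apply/measurable_fun_tnthP => i.
  rewrite (_ : _ \o _ = fun w => g w i)//.
  by apply/funext => w /=; rewrite tnth_mktuple.
exact: mt.
Qed.

Lemma measurable_tau : measurable_fun setT (@tau R : X -> X).
Proof. by apply: measurable_to_sequence => n; exact: measurable_coordinate. Qed.

(** Puts two cylinders over a common number of coordinates, where unions and differences are those
    of the bases. *)
Lemma cylinder_widen (k m : nat) (B : set (k.+1.-tuple R)) : (k <= m)%N -> measurable B ->
  exists2 B' : set (m.+1.-tuple R), measurable B' &
    [set x : nat -> R | B [tuple x i | i < k.+1]] =
    [set x : nat -> R | B' [tuple x i | i < m.+1]].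
Proof.
move=> km mB; have km1 : (k.+1 <= m.+1)%N by [].
pose g (t : m.+1.-tuple R) := [tuple tnth t (widen_ord km1 i) | i < k.+1].
have mg : measurable_fun setT g.
  apply/measurable_fun_tnthP => i.
  rewrite (_ : _ \o _ = @tnth _ R ^~ (widen_ord km1 i)); first exact: measurable_tnth.
  by apply/funext => t /=; rewrite tnth_mktuple.
exists (g @^-1` B); first by rewrite -[X in measurable X]setTI; exact: mg.
apply/funext => x; rewrite /preimage/= /g; congr B.
by apply: eq_from_tnth => i; rewrite !tnth_mktuple.
Qed.

Lemma setring_cylinders : setring (@cylinders R).
Proof.
have common C D : cylinders C -> cylinders D ->
    exists m, exists B B' : set (m.+1.-tuple R), [/\ measurable B, measurable B',
      C = [set x | B [tuple x i | i < m.+1]] & D = [set x | B' [tuple x i | i < m.+1]]].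
  move=> [k [B [mB ->]]] [l [B' [mB' ->]]]; exists (maxn k l).
  have [B1 mB1 ->] := cylinder_widen (leq_maxl k l) mB.
  have [B2 mB2 ->] := cylinder_widen (leq_maxr k l) mB'.
  by exists B1, B2.
split.
- by exists 0%N, set0; split => //; apply/seteqP; split.
- move=> C D cC cD; have [m [B [B' [mB mB' -> ->]]]] := common _ _ cC cD.
  by exists m, (B `|` B'); split => //; exact: measurableU.
- move=> C D cC cD; have [m [B [B' [mB mB' -> ->]]]] := common _ _ cC cD.
  by exists m, (B `\` B'); split => //; exact: measurableD.
Qed.

(** The monotone class theorem reaches the generated sigma-ring; the whole space being a cylinder,
    this ring is closed under complements and contains the sigma-algebra. *)
Lemma cylinders_monotone_class (G : set (set (nat -> R))) :
  monotone G -> @cylinders R `<=` G -> <<s @cylinders R >> `<=` G.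
Proof.
move=> mG cG; apply: subset_trans (monotone_setring_sub_g_sigma_ring mG setring_cylinders cG).
have [sr0 srD srU] := smallest_sigma_ring (@cylinders R).
apply: smallest_sub; last exact: sub_g_sigma_ring.
split => // A srA; apply: srD => //; apply: sub_g_sigma_ring.
by exists 0%N, setT; split => //; apply/seteqP; split.
Qed.

Section Law.
Context {d : measure_display} {T : measurableType d}.
Variables (nu : set T -> R) (f : nat -> T -> R).
Hypothesis nu_cap : is_capacity nu.
Hypothesis nu_convex : convex_capacity nu.
Hypothesis nu_cont : continuous_at_setT nu.
Hypothesis mf : forall n, measurable_fun setT (f n).

Let path : T -> X := fun w n => f n w.
Let mu : set X -> R := law nu f.

Lemma measurable_path_preimage (C : set X) : measurable C -> measurable (path @^-1` C).
Proof.
by move=> mC; rewrite -[X in measurable X]setTI; exact: (measurable_to_sequence (g := path)).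
Qed.

Lemma law_capacity : is_capacity mu.
Proof.
split.
- by move=> A /measurable_path_preimage; exact: capacity_range.
- exact: (capacity_set0 nu_cap).
- exact: (capacity_setT nu_cap).
- move=> A B mA mB AB; apply: (capacity_le nu_cap); try exact: measurable_path_preimage.
  by move=> w; exact: AB.
Qed.

Lemma law_convex : convex_capacity mu.
Proof. by move=> A B mA mB; apply: nu_convex; exact: measurable_path_preimage. Qed.

Lemma law_continuous : continuous_at_setT mu.
Proof.
move=> A mA ndA UA; apply: (nu_cont (A := fun n => path @^-1` A n)).
- by move=> n; exact: measurable_path_preimage.
- by move=> n w; exact: ndA.
- by rewrite -preimage_bigcup UA.
Qed.

(** The law need not be additive, so the sets whose capacity the shift preserves need not form a
    Dynkin system; continuity along monotone sequences makes them a monotone class. *)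
Lemma law_tau : stationary nu f ->
  forall C : set X, measurable C -> mu (@tau R @^-1` C) = mu C.
Proof.
move=> f_st.
have mtau (C : set X) : measurable C -> measurable (@tau R @^-1` C : set X).
  by move=> mC; rewrite -[X in measurable X]setTI; exact: measurable_tau.
pose G := [set C : set X | measurable C /\ mu (@tau R @^-1` C) = mu C].
have up := capacity_cvg_bigcup law_capacity law_convex law_continuous.
have down := capacity_cvg_bigcap law_capacity law_convex law_continuous.
suff : <<s @cylinders R >> `<=` G by move=> h C /h[].
apply: cylinders_monotone_class; first split.
- refine (fun (F : nat -> set X) ndF GF => _); have mF i : measurable (F i) by have [] := GF i.
  split; first exact: bigcup_measurable.
  have ndF' i : F i `<=` F i.+1 by apply/subsetPset/ndF.
  have lim1 := up _ mF ndF'.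
  have lim2 := up (fun i => @tau R @^-1` F i) (fun i => mtau _ (mF i))
    (fun i x => ndF' i (tau x)).
  have E : (fun i => mu (@tau R @^-1` F i)) = (fun i => mu (F i)).
    by apply/funext => i; case: (GF i).
  by rewrite E in lim2; rewrite preimage_bigcup; exact: (cvg_unique _ lim2 lim1).
- refine (fun (F : nat -> set X) niF GF => _); have mF i : measurable (F i) by have [] := GF i.
  split; first exact: bigcap_measurable.
  have niF' i : F i.+1 `<=` F i by apply/subsetPset/niF.
  have lim1 := down _ mF niF'.
  have lim2 := down (fun i => @tau R @^-1` F i) (fun i => mtau _ (mF i))
    (fun i x => niF' i (tau x)).
  have E : (fun i => mu (@tau R @^-1` F i)) = (fun i => mu (F i)).
    by apply/funext => i; case: (GF i).
  by rewrite E in lim2; rewrite preimage_bigcap; exact: (cvg_unique _ lim2 lim1).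
- move=> C cC; split; first exact: sub_sigma_algebra.
  by case: cC => k [B [mB ->]]; have := f_st 0%N k B mB; exact: esym.
Qed.

End Law.
End SequenceSpace.

(** * Transfer from the sequence space to the original process *)

Theorem theorem4 (R : realType) (d : measure_display) (T : measurableType d)
    (nu : set T -> R) (f : nat -> T -> R)
    (nu_capacity : is_capacity nu)
    (nu_convex : convex_capacity nu)
    (nu_continuous : continuous_at_setT nu)
    (f_measurable : forall n, measurable_fun setT (f n))
    (f_bounded : forall n, bounded_fun (f n))
    (f_stationary : stationary nu f)
    (f_ergodic : ergodic nu f) :
  let mean (w : T) : nat -> R :=
    fun n => n.+1%:R^-1 * \sum_(k < n.+1) f k w in
  nu [set w | cvgn (mean w) /\
    choquet nu (f 0%N) <= limn (mean w) <= choquet (conjugate nu) (f 0%N)] = 1.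
Proof.
move=> mean.
pose X := g_sigma_algebraType (@cylinders R).
pose path : T -> X := fun w n => f n w.
pose mu : set X -> R := law nu f.
have mu_cap : is_capacity mu := law_capacity nu_capacity f_measurable.
have mu_convex : convex_capacity mu := law_convex nu_convex f_measurable.
have mu_cont : continuous_at_setT mu := law_continuous nu_continuous f_measurable.
have mtau := @measurable_tau R.
have mu_tau := law_tau nu_capacity nu_convex nu_continuous f_measurable f_stationary.
have mu01 (A : set X) : measurable A -> @tau R @^-1` A = A -> mu A = 0 \/ mu A = 1.
  move=> mA tA.
  have : [set mu C | C in [set C | <<s @cylinders R >> C /\ @tau R @^-1` C = C]] (mu A).
    by exists A.
  by have := f_ergodic; rewrite /ergodic /shift_ergodic => ->.
have [m0 [_ f0m]] := f_bounded 0%N.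
pose m := `|m0| + 1.
have m_gt0 : 0 < m by rewrite ltr_wpDl.
have f0_le w : `|f 0%N w| <= m.
  by apply: f0m => //; rewrite /m; apply: le_lt_trans (ler_norm m0) _; rewrite ltrDl.
(* Coordinates are unbounded on the sequence space, so the ergodic theorem is
   applied to a truncation of the first one. *)
pose phi (x : X) : R := Num.max (- m) (Num.min m (x 0%N)).
have phi_id (x : X) : `|x 0%N| <= m -> phi x = x 0%N.
  by rewrite ler_norml /phi => /andP[h1 h2]; rewrite min_r// max_r.
have mphi : measurable_fun setT phi.
  apply: measurable_maxr => //; apply: measurable_minr => //.
  exact: measurable_coordinate.
have phi_lt x : `|phi x| < m + 1.
  apply: (@le_lt_trans _ _ m); last by rewrite ltrDl.
  rewrite ler_norml /phi le_max lexx/= ge_max ge_min lexx/= andbT.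
  by apply: (@le_trans _ _ 0); rewrite ?oppr_le0 ltW.
have phi_path : (fun w => phi (path w)) = f 0%N.
  by apply/funext => w; exact/phi_id/f0_le.
have mNphi : measurable_fun setT (fun x => - phi x) by exact: measurable_funN.
have Nphi_lt x : `|- phi x| < m + 1 by rewrite normrN.
have inf_sup := birkhoff_sup_le_inf mu_cap mu_convex mu_cont mtau mu_tau mphi phi_lt.
have lower := choquet_le_birkhoff_inf mu_cap mu_convex mu_cont mtau mu_tau mphi phi_lt mu01.
have upper := choquet_le_birkhoff_inf mu_cap mu_convex mu_cont mtau mu_tau mNphi Nphi_lt mu01.
have NNphi : (fun x : X => - - phi x) = phi by apply/funext => x; rewrite opprK.
(* [upper] then bounds the upper limit of the means of [phi] by minus the Choquet integral of
   [- phi], which [conj_le] compares with the conjugate integral. *)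
rewrite NNphi in upper.
have conj_le := oppr_choquet_le_conjugate mu_cap mphi phi_lt.
have choquet_nu : choquet mu phi = choquet nu (f 0%N) by rewrite -phi_path.
have choquet_conj : choquet (conjugate mu) phi = choquet (conjugate nu) (f 0%N).
  by rewrite -phi_path.
have m_coord k : measurable [set x : X | `|x k| <= m].
  apply: measurable_set_le => //; apply: measurableT_comp => //.
  exact: measurable_coordinate.
(* By invariance every coordinate inherits, with capacity 1, the bound [m] of the first; [f k]
   itself may have a larger bound. *)
have coord1 k : mu [set x : X | `|x k| <= m] = 1.
  rewrite (_ : [set x | _] = iter k (@tau R) @^-1` [set x : X | `|x 0%N| <= m]).
    apply: etrans (capacity_iter_preimage mtau mu_tau k (m_coord 0%N)) _; rewrite /law.
    rewrite (_ : _ @^-1` _ = setT) ?(capacity_setT nu_capacity)//.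
    by apply/seteqP; split => w // _; exact: f0_le.
  by apply/funext => x; rewrite /preimage/= iter_tau.
have coords1 := capacity_bigcap1 mu_cap mu_convex mu_cont m_coord coord1.
have m_coords := bigcap_measurableType (fun k (_ : setT k) => m_coord k).
have m_sup := measurable_birkhoff_sup mtau mphi phi_lt.
have m_inf : measurable_fun setT (fun x : X => - birkhoff_sup (@tau R) (fun y : X => - phi y) x).
  by apply: measurable_funN; exact: (measurable_birkhoff_sup mtau mNphi Nphi_lt).
have m_supN := measurable_funN m_sup.
set D1 := \bigcap_k _ in coords1 m_coords.
set D2 := [set x | _] in inf_sup.
set D3 := [set x | _] in lower.
set D4 := [set x | _] in upper.
have mD2 : measurable D2 by exact: measurable_set_le.
have mD3 : measurable D3 by exact: measurable_set_le.
have mD4 : measurable D4 by exact: measurable_set_le.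
have muD : mu ((D1 `&` D2) `&` (D3 `&` D4)) = 1.
  have mD12 := measurableI _ _ m_coords mD2.
  have mD34 := measurableI _ _ mD3 mD4.
  by apply: (capacity_setI1 mu_cap mu_convex) => //;
    apply: (capacity_setI1 mu_cap mu_convex).
apply: (capacity_le1S nu_capacity _ _ _ muD).
- apply: (measurable_path_preimage f_measurable).
  by apply: measurableI; apply: measurableI.
- apply: measurable_limn_itv => n; apply: measurable_funM => //.
  exact: measurable_sum.
move=> w [[D1w D2w] [D3w D4w]].
(* Where all coordinates are bounded by [m], the truncation is the identity along the whole
   orbit. *)
have meanE : mean w = birkhoff_mean (@tau R) phi ^~ (path w).
  apply/funext => n; congr (_ * _); apply: eq_bigr => k _.
  rewrite phi_id iter_tau//; exact: (D1w k I).
have cvg_mean : mean w @ \oo --> birkhoff_sup (@tau R) phi (path w).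
  rewrite meanE; apply: limn_sup_cvg.
    exact: (birkhoff_mean_bounded _ (fun x => ltW (phi_lt x))).
  apply: le_trans D2w _; rewrite lerN2 /birkhoff_sup.
  by under eq_fun do rewrite -birkhoff_meanN.
have limE : limn (mean w) = birkhoff_sup (@tau R) phi (path w) by apply: cvg_lim.
split; first by apply/cvg_ex; eexists; exact: cvg_mean.
(* The opposite means converge, so their upper limit is their limit. *)
have inf_le : - birkhoff_sup (@tau R) (fun y : X => - phi y) (path w) <=
    birkhoff_sup (@tau R) phi (path w).
  have : (birkhoff_mean (@tau R) (fun y : X => - phi y) ^~ (path w)) @ \oo -->
      - birkhoff_sup (@tau R) phi (path w).
    under eq_fun do rewrite birkhoff_meanN.
    by rewrite meanE in cvg_mean; exact: cvgN.
  by move=> /cvg_limn_inf_sup[_ E]; rewrite [X in - X <= _]E opprK.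
rewrite limE -choquet_nu -choquet_conj; apply/andP; split.
  exact: le_trans D3w inf_le.
apply: le_trans conj_le; rewrite lerNr; exact: D4w.
Qed.
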